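(* Let $(\Omega,\mathcal F,(\mathcal F_t)_{t\in\mathbb N_0})$ be a filtered measurable space, $\mathcal P$ a family of probability measures on $(\Omega,\mathcal F)$, and $Q$ a probability measure on $(\Omega,\mathcal F)$. Let $(\alpha_k)_{k\ge1}$ be a decreasing sequence in $(0,1)$ with $\alpha_k\downarrow0$, put $b_k:=\log(1/\alpha_k)$, and for each $k$ let $\tau_k$ be an $(\mathcal F_t)$-stopping time with values in $\mathbb N_0\cup\{\infty\}$ such that $\sup_{P\in\mathcal P}P(\tau_k<\infty)\le\alpha_k$. Assume the family is nested: $j\le k$ implies $\tau_j\le\tau_k$ pathwise on $\Omega$. Let $(w_k)_{k\ge1}$ be nonnegative weights, not all zero, with $\sum_{k=1}^\infty w_k\alpha_k\le1$, and define $$M_t:=\sum_{k=1}^\infty w_k\mathbf 1_{\{\tau_k\le t\}}\ (t\in\mathbb N_0),\qquad W(x):=\sum_{k:\,b_k\le x}w_k\ (x\ge0).$$ Assume that $W(x)\to\infty$ as $x\to\infty$ and that $\frac{\log W(x)}{x}\to\rho$ as $x\to\infty$ for some $\rho\in[0,1]$. Let $I\in(0,\infty)$ and suppose that at least one of the following holds as $k\to\infty$: 1. $\displaystyle\frac{\mathbb E_Q\left[\left|\tau_k-\frac{b_k}{I}\right|\right]}{b_k}\longrightarrow0$; 2. $\displaystyle\frac{\mathbb E_Q[\tau_k]}{b_k}\longrightarrow\frac1I$ and $\displaystyle\frac{\operatorname{Var}_Q(\tau_k)}{b_k^2}\longrightarrow0$. Then, in $Q$-probability as $t\to\infty$, $$\frac1t\log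 M_t\longrightarrow\rho I.$$
   Context: $\mathbb N_0=\{0,1,2,\dots\}$. The process $M_t$ takes values in $[0,\infty]$, with the conventions $\log 0=-\infty$, $\log\infty=\infty$. Since $b_k\uparrow\infty$, $W(x)$ is a finite sum for each $x$. The limits in conditions 1 and 2 entail that the expectations (and variances) involved are finite for all large $k$. *)

(* Defs.v *)
From mathcomp Require Export all_boot all_order all_algebra.
From mathcomp Require Export all_classical all_reals all_analysis.
Export Order.TTheory GRing.Theory Num.Theory.
Export numFieldNormedType.Exports.

Set Implicit Arguments.
Unset Strict Implicit.
Unset Printing Implicit Defensive.

Local Open Scope classical_set_scope.
Local Open Scope ring_scope.
Local Open Scope ereal_scope.

Definition filtration (d : measure_display) (T : measurableType d)
    (F : nat -> set (set T)) : Prop :=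
  [/\ forall t, sigma_algebra setT (F t),
      forall t, F t `<=` measurable &
      forall s t, (s <= t)%N -> F s `<=` F t].

Definition stopping_time (R : realType) (T : Type) (F : nat -> set (set T))
    (tau : T -> \bar R) : Prop :=
  (forall x, tau x = +oo \/ exists n : nat, tau x = n%:R%:E) /\
  (forall t : nat, F t [set x | tau x <= t%:R%:E]).

(* The library's 'E_P[X] and 'V_P[X] only apply to real-valued X; the next two
   definitions are their analogues for X with values in \bar R. *)
Definition mean (R : realType) (d : measure_display) (T : measurableType d)
    (Q : probability T R) (X : T -> \bar R) : \bar R :=
  \int[Q]_x X x.

Definition evariance (R : realType) (d : measure_display) (T : measurableType d)
    (Q : probability T R) (X : T -> \bar R) : \bar R :=
  mean Q (fun x => (X x - mean Q X) ^+ 2).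

Definition cvg_in_probability (R : realType) (d : measure_display)
    (T : measurableType d) (Q : probability T R)
    (Y : nat -> T -> \bar R) (c : R) : Prop :=
  forall eps : R, (0 < eps)%R ->
    Q [set x | eps%:E < `|Y t x - c%:E| ] @[t --> \oo] --> 0.

(* Sequences are indexed by k >= 1; their entries at k = 0 are never used. *)

Definition log_level (R : realType) (alpha : nat -> R) (k : nat) : R :=
  ln (1 / alpha k)%R.

Definition weighted_process (R : realType) (T : Type) (w : nat -> R)
    (tau : nat -> T -> \bar R) (t : nat) (x : T) : \bar R :=
  \sum_(1 <= k <oo) (w k * \1_[set y | (tau k y <= t%:R%:E)%E] x)%:E.

(* A sum over a set with infinite support is 0 by convention; this does not
   occur here, because b k tends to +oo. *)
Definition cumulative_weight (R : realType) (w b : nat -> R) (x : R) : R :=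
  (\sum_(k \in [set k : nat | (1 <= k)%N /\ (b k <= x)%R]) w k)%R.

(* Main.v *)
(* By Markov's (condition 1) or Chebyshev's (condition 2) inequality,
   Q(|tau_k - b_k / I| >= eta b_k) tends to 0 for every eta > 0. Fix a small
   delta > 0. If l is the largest index with b_l <= t I (1 - delta), then
   tau_l <= t outside an event of vanishing probability, and by nesting
   M_t >= W(t I (1 - delta)). If u is the smallest index with
   b_u > t I (1 + delta), then likewise tau_u > t with probability tending
   to 1, so only indices below u contribute and M_t <= W(t I (1 + delta)).
   Taking logarithms and dividing by t, both bounds are close to rho I. *)

Require Import Defs.
From mathcomp Require Import measurable_realfun ring lra.

Local Open Scope classical_set_scope.
Local Open Scope ring_scope.

(** * Measurability of the stopping times, of the extended logarithm and of the process *)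

Lemma measurable_fun_sublevel (R : realType) (d : measure_display)
    (T : measurableType d) (f : T -> \bar R) :
  (forall r : R, measurable [set x | (f x <= r%:E)%E]) ->
  measurable_fun setT f.
Proof.
move=> mf mD; apply: (measurability _ (ErealGenOInfty.measurableE R)) => //.
move=> _ [_ [r ->] <-]; rewrite setTI.
rewrite [X in measurable X](_ : _ = ~` [set x | (f x <= r%:E)%E]).
  exact: measurableC.
apply/seteqP; split=> x /=; rewrite in_itv/= andbT ltNge => /negP //.
Qed.

(** The values are natural numbers or [+oo], so for [r >= 0] the sublevel set at [r] is the one at
    the integer part of [r], which lies in the filtration; for [r < 0] it is empty. *)
Lemma measurable_stopping_time (R : realType) (d : measure_display)
    (T : measurableType d) (F : nat -> set (set T)) (tau : T -> \bar R) :
  filtration F -> stopping_time F tau -> measurable_fun setT tau.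
Proof.
move=> [_ Fm _] [tauN tauF]; apply: measurable_fun_sublevel => r.
have [r0|r0] := ltP r 0.
  rewrite [X in measurable X](_ : _ = set0)//.
  apply/seteqP; split=> x //=; case: (tauN x) => [->|[n ->]].
    by rewrite leye_eq.
  by rewrite lee_fin leNgt (lt_le_trans r0).
have /Fm := tauF (Num.trunc r); congr measurable.
apply/seteqP; split=> x /=; case: (tauN x) => [->|[n ->]];
  by rewrite ?leye_eq// !lee_fin ler_nat truncn_ge_nat.
Qed.

(** No sign condition on [x] is required: [lne] is [-oo] at nonpositive arguments, and [expR r] is
    positive. *)
Lemma lne_le_EFin (R : realType) (x : \bar R) (r : R) :
  (lne x <= r%:E)%E = (x <= (expR r)%:E)%E.
Proof.
case: x => [x| |]; rewrite ?leye_eq ?leNye//=; case: ifPn => [x0|].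
  by rewrite leNye lee_fin (le_trans x0) ?expR_ge0.
by rewrite -ltNge => x0; rewrite !lee_fin -[RHS]ler_ln ?posrE ?expR_gt0// expRK.
Qed.

Lemma measurable_fun_lne (R : realType) (d : measure_display)
    (T : measurableType d) (f : T -> \bar R) :
  measurable_fun setT f -> measurable_fun setT (fun x => lne (f x)).
Proof.
move=> mf; apply: measurable_fun_sublevel => r.
under eq_set do rewrite lne_le_EFin.
by rewrite -[X in measurable X]setTI; exact: emeasurable_fun_infty_c.
Qed.

Lemma measurable_weighted_process (R : realType) (d : measure_display)
    (T : measurableType d) (w : nat -> R) (tau : nat -> T -> \bar R) (t : nat) :
  (forall k, (1 <= k)%N -> 0 <= w k) ->
  (forall k, (1 <= k)%N -> measurable_fun setT (tau k)) ->
  measurable_fun setT (weighted_process w tau t).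
Proof.
move=> w0 mtau; rewrite /weighted_process.
under eq_fun do rewrite eseries_cond.
apply: ge0_emeasurable_sum => [k x _ /w0 wk|k k1].
  by rewrite lee_fin mulr_ge0.
apply/measurable_EFinP; apply: measurable_funM => //.
apply: measurable_indic; rewrite -[X in measurable X]setTI.
by apply: emeasurable_fun_infty_c => //; exact: mtau.
Qed.

(** * Comparison of the process with partial sums of the weights *)

Lemma weighted_process_ge (R : realType) (T : Type) (w : nat -> R)
    (tau : nat -> T -> \bar R) (n t : nat) (x : T) :
  (forall k, (1 <= k)%N -> 0 <= w k) ->
  (forall k, (1 <= k < n)%N -> (tau k x <= t%:R%:E)%E) ->
  ((\sum_(1 <= k < n) w k)%:E <= weighted_process w tau t x)%E.
Proof.
move=> w0 taut; rewrite -sumEFin.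
apply: (le_trans _ (nneseries_lim_ge n _)) => [|k k1 _]; last first.
  by rewrite lee_fin mulr_ge0// w0.
rewrite big_nat [leRHS]big_nat; apply: lee_sum => k /taut tk.
by rewrite indicE mem_set// mulr1.
Qed.

Lemma weighted_process_le (R : realType) (T : Type) (w : nat -> R)
    (tau : nat -> T -> \bar R) (n t : nat) (x : T) :
  (1 <= n)%N ->
  (forall k, (1 <= k)%N -> 0 <= w k) ->
  (forall k, (n <= k)%N -> (t%:R%:E < tau k x)%E) ->
  (weighted_process w tau t x <= (\sum_(1 <= k < n) w k)%:E)%E.
Proof.
(* The series starts at index 1, so splitting off [n.-1] terms cuts it exactly at [n]; every term of
   the tail vanishes. *)
move=> n1 w0 taut; rewrite /weighted_process (nneseries_split 1 n.-1); last first.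
  by move=> k k1; rewrite lee_fin mulr_ge0// w0.
rewrite add1n prednK// [X in (_ + X)%E]eseries0 ?adde0; last first.
  move=> k nk _; rewrite indicE memNset ?mulr0//=.
  by apply/negP; rewrite -ltNge taut.
rewrite -sumEFin big_nat [leRHS]big_nat; apply: lee_sum => k /andP[k1 _].
by rewrite lee_fin ler_piMr ?w0// indicE; case: (_ \in _).
Qed.

(** * Deviations of a stopping time from its scale [b / I] *)

Lemma cvge0_le (R : realType) (u v : nat -> \bar R) (c : R) :
  v k @[k --> \oo] --> 0%E ->
  (\forall k \near \oo, (0 <= u k)%E /\ (u k <= v k * c%:E)%E) ->
  u k @[k --> \oo] --> 0%E.
Proof.
move=> v0 uv; apply: (@squeeze_cvge _ _ _ _ (fun=> 0%E) u (fun k => v k * c%:E)%E).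
- by apply: filterS uv => k [-> ->].
- exact: cvg_cst.
- by rewrite -(mul0e c%:E); apply: cvgeZr.
Qed.

(** With [u = b / I], the hypothesis reads [u <= t * (1 - delta)], so [s - u] exceeds [t - u], which
    is at least [delta / 2 * u]. For [s = +oo] the deviation is infinite. *)
Lemma deviation_gt (R : realType) (delta I t b : R) (s : \bar R) :
  0 < delta < 1 -> 0 < I -> 0 < t ->
  b <= t * (I * (1 - delta)) -> (t%:E < s)%E ->
  ((delta / 2 / I * b)%:E <= `|s - (b * I^-1)%:E|)%E.
Proof.
move=> /andP[d0 d1] I0 t0 bt; case: s => [s| |]//=; last by rewrite leey.
rewrite lte_fin lee_fin => ts; apply: (le_trans _ (ler_norm _)).
pose u := b / I.
have ut : u <= t * (1 - delta) by rewrite /u ler_pdivrMr// -mulrA (mulrC _ I).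
have -> : delta / 2 / I * b = delta / 2 * u by rewrite /u; field; rewrite gt_eqF.
have td : 0 < t * delta by exact: mulr_gt0.
have : 0 <= (t - u) * delta by apply: mulr_ge0; lra.
rewrite -/u; nra.
Qed.

(** Here [u = b / I] exceeds [t * (1 + delta)], so [u - t] exceeds [u * delta / (1 + delta)]. Since
    [1 + delta < 2], this is at least [delta / 2 * u], whence the factor 1/2 in the threshold. *)
Lemma deviation_le (R : realType) (delta I t b : R) (s : \bar R) :
  0 < delta < 1 -> 0 < I -> 0 < t ->
  t * (I * (1 + delta)) < b -> (s <= t%:E)%E ->
  ((delta / 2 / I * b)%:E <= `|s - (b * I^-1)%:E|)%E.
Proof.
move=> /andP[d0 d1] I0 t0 tb; case: s => [s| |]//=; last by rewrite leey.
rewrite !lee_fin distrC => st; apply: (le_trans _ (ler_norm _)).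
pose u := b / I.
have tu : t * (1 + delta) < u by rewrite /u ltr_pdivlMr// -mulrA (mulrC _ I).
have -> : delta / 2 / I * b = delta / 2 * u by rewrite /u; field; rewrite gt_eqF.
rewrite -/u.
have u0 : 0 < u by nra.
(* Multiplying by [1 + delta] removes the fraction; what remains is at least
   [u * delta * (1 - delta) / 2]. *)
suff : 0 <= (1 + delta) * (u * (1 - delta / 2) - t).
  rewrite pmulr_rge0; lra.
have : 0 < u * delta * (1 - delta) by apply: mulr_gt0; [exact: mulr_gt0|lra].
nra.
Qed.

Section concentration.
Context (R : realType) (d : measure_display) (T : measurableType d).
Variables (Q : probability T R) (tau : nat -> T -> \bar R) (b : nat -> R).
Variable (c : R).
Hypothesis mtau : forall k, (1 <= k)%N -> measurable_fun setT (tau k).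
Hypothesis b_gt0 : forall k, (1 <= k)%N -> 0 < b k.

(** The constant [c] stands for the inverse of the rate [I]. The inequality is non-strict, as in
    Markov's inequality. *)
Definition deviation (eta : R) (k : nat) : set T :=
  [set x | ((eta * b k)%:E <= `|tau k x - (b k * c)%:E|)%E].

Lemma measurable_deviation eta k : (1 <= k)%N -> measurable (deviation eta k).
Proof.
move=> k1; rewrite -[X in measurable X]setTI.
apply: emeasurable_fun_c_infty => //; apply: measurableT_comp => //.
by apply: emeasurable_funB => //; exact: mtau.
Qed.

(** Markov's inequality at level [eta * b k] bounds the probability by [eta^-1] times the normalised
    mean deviation. *)
Lemma concentration_of_mean eta : 0 < eta ->
  (mean Q (fun x => `|tau k x - (b k * c)%:E|) / (b k)%:E)%E
    @[k --> \oo] --> 0%E ->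
  Q (deviation eta k) @[k --> \oo] --> 0%E.
Proof.
move=> eta0 mcvg; apply: (cvge0_le _ _ _ eta^-1 mcvg); exists 1%N => // k /= k1.
have bk := b_gt0 _ k1; split; first exact: measure_ge0.
rewrite inver gt_eqF// -muleA -EFinM.
have -> : ((b k)^-1 * eta^-1) = (eta * b k)^-1.
  by rewrite invfM mulrC.
rewrite lee_pdivlMr ?mulr_gt0// muleC.
have := @le_integral_abse _ _ _ Q _ measurableT
  (fun x => tau k x - (b k * c)%:E)%E (eta * b k).
rewrite setTI; apply; last exact: mulr_gt0.
by apply: emeasurable_funB => //; exact: mtau.
Qed.

(** The variance is centred at the mean, not at [b k * c]. Eventually the two centres differ by less
    than [eta / 2 * b k], so the other half of the threshold is left for Chebyshev's inequality. *)
Lemma concentration_of_variance eta : 0 < eta ->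
  (mean Q (tau k) / (b k)%:E)%E @[k --> \oo] --> c%:E ->
  (evariance Q (tau k) / ((b k) ^+ 2)%:E)%E @[k --> \oo] --> 0%E ->
  Q (deviation eta k) @[k --> \oo] --> 0%E.
Proof.
move=> eta0 /fine_cvgP[mfin mcvg] vcvg.
apply: (cvge0_le _ _ _ ((eta / 2) ^+ 2)^-1 vcvg).
have mnear : \forall k \near \oo,
    `|c - fine (mean Q (tau k) / (b k)%:E)%E| < eta / 2.
  by move/cvgrPdist_lt : mcvg; apply; rewrite divr_gt0.
near=> k.
have k1 : (1 <= k)%N by near: k; exists 1%N.
have bk := b_gt0 _ k1; split; first exact: measure_ge0.
(* An infinite mean divided by the positive [b k] would stay infinite, so a finite ratio forces a
   finite mean. *)
have [m mE mb] : exists2 m, mean Q (tau k) = m%:E & `|m - b k * c| < eta / 2 * b k.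
  have : (mean Q (tau k) / (b k)%:E)%E \is a fin_num by near: k.
  have : `|c - fine (mean Q (tau k) / (b k)%:E)%E| < eta / 2 by near: k.
  case: (mean Q (tau k)) => [m| |]; rewrite inver gt_eqF//=; last 2 first.
  - by rewrite gt0_mulye ?lte_fin ?invr_gt0.
  - by rewrite gt0_mulNye ?lte_fin ?invr_gt0.
  move=> mc _; exists m => //.
  have -> : m - b k * c = (m / b k - c) * b k by field; rewrite gt_eqF.
  by rewrite normrM (gtr0_norm bk) distrC ltr_pM2r.
set g := (fun x => (tau k x - m%:E) ^+ 2)%E.
have mg : measurable_fun setT g.
  rewrite /g; under eq_fun do rewrite expe2.
  by apply: emeasurable_funM; apply: emeasurable_funB => //; exact: mtau.
have g0 x : (0 <= g x)%E by rewrite /g expe2 sqre_ge0.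
pose a := (eta / 2 * b k) ^+ 2.
have a0 : 0 < a by rewrite exprn_gt0 ?mulr_gt0 ?divr_gt0.
(* For a finite value of [tau k x] this is the triangle inequality through [m]; for an infinite one
   [g x] is [+oo]. *)
have sub : deviation eta k `<=` [set x | (a%:E <= `|g x|)%E].
  move=> x; rewrite /deviation /= (gee0_abs (g0 x)) /g.
  case: (tau k x) => [s| |]; last 2 first.
  - by move=> _; rewrite expe2 mulyy leey.
  - by move=> _; rewrite expe2 mulNyNy leey.
  rewrite -!EFinB -EFin_expe abse_EFin !lee_fin => dev.
  rewrite /a -[leRHS]real_normK ?num_real//.
  rewrite ler_pXn2r ?nnegrE//; last by rewrite ltW// mulr_gt0 ?divr_gt0.
  have := ler_distD m s (b k * c); move: mb dev; lra.
have := @le_integral_abse _ _ _ Q _ measurableT g a mg a0.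
rewrite setTI => markov.
rewrite inver gt_eqF ?exprn_gt0// -muleA -EFinM.
have -> : (b k ^+ 2)^-1 * ((eta / 2) ^+ 2)^-1 = a^-1.
  by rewrite -invfM mulrC -exprMn.
rewrite lee_pdivlMr// muleC.
apply: (@le_trans _ _ (a%:E * Q [set x | (a%:E <= `|g x|)%E])%E).
  rewrite lee_pmul2l// le_measure ?inE//; first exact: measurable_deviation.
  rewrite -[X in measurable X]setTI; apply: emeasurable_fun_c_infty => //.
  exact: measurableT_comp.
apply: (le_trans markov); rewrite /evariance mE /mean.
by under eq_integral => x _ do rewrite gee0_abs//.
Unshelve. all: by end_near. Qed.

End concentration.

(** * The levels [b k] and the indices lying below a given level *)

Section log_level.
Context (R : realType) (alpha : nat -> R).
Hypothesis alpha_in01 : forall k, (1 <= k)%N -> 0 < alpha k < 1.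

Lemma log_level_gt0 k : (1 <= k)%N -> 0 < log_level alpha k.
Proof.
move=> /alpha_in01 /andP[a0 a1].
by rewrite /log_level div1r lnV ?posrE// oppr_gt0 ln_lt0// a0.
Qed.

Lemma log_level_le j k : (1 <= j)%N -> (1 <= k)%N -> alpha k <= alpha j ->
  log_level alpha j <= log_level alpha k.
Proof.
move=> /alpha_in01 /andP[aj0 _] /alpha_in01 /andP[ak0 _] kj.
by rewrite /log_level !div1r !lnV ?posrE// lerN2 ler_ln ?posrE.
Qed.

Lemma log_level_cvgy : alpha k @[k --> \oo] --> (0 : R) ->
  log_level alpha k @[k --> \oo] --> +oo.
Proof.
move=> /cvgrPdist_lt a0; apply/cvgryPge => A; near=> k.
have /alpha_in01 /andP[ak0 _] : (1 <= k)%N by near: k; exists 1%N.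
have : `|0 - alpha k| < expR (- A) by near: k; apply: a0; exact: expR_gt0.
rewrite sub0r normrN gtr0_norm// => ak.
rewrite /log_level div1r lnV ?posrE// lerNr -[leRHS]expRK.
by rewrite ler_ln ?posrE ?expR_gt0// ltW.
Unshelve. all: by end_near. Qed.

End log_level.

(** By monotonicity the indices with [b k <= x] form an initial segment, finite by divergence. The
    witness [n] is the least index [>= 1] with [x < b n]; it equals 1 when the segment is empty. *)
Lemma level_index (R : realType) (b : nat -> R) (x : R) :
  (forall j k, (1 <= j)%N -> (j <= k)%N -> b j <= b k) ->
  b k @[k --> \oo] --> +oo ->
  exists n, (1 <= n)%N /\ forall k, (1 <= k)%N -> (b k <= x) = (k < n)%N.
Proof.
move=> b_le /cvgryPgt /(_ x) [N _ bN].
have exn : exists n, (1 <= n)%N && (x < b n).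
  by exists N.+1; apply: bN => /=; exact: leqnSn.
exists (ex_minn exn); case: ex_minnP => n /andP[n1 xn] nmin; split=> // k k1.
have [kn|nk] := ltnP k n.
  by rewrite leNgt; apply/negP => xk; have := nmin k; rewrite k1 xk leqNgt kn => /(_ isT).
by apply/negbTE; rewrite -ltNge (lt_le_trans xn)// b_le.
Qed.

Lemma cumulative_weightE (R : realType) (w b : nat -> R) (x : R) (n : nat) :
  (forall k, (1 <= k)%N -> (b k <= x) = (k < n)%N) ->
  cumulative_weight w b x = \sum_(1 <= k < n) w k.
Proof.
move=> bn; rewrite /cumulative_weight.
rewrite (_ : [set k | _] = [set` index_iota 1 n]).
  by rewrite -fsbig_seq ?iota_uniq.
apply/seteqP; split=> k /=; rewrite mem_index_iota.
  by move=> [k1]; rewrite bn// k1.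
by move=> /andP[k1 kn]; rewrite bn.
Qed.

(** * Bracketing the growth rate and convergence in probability *)

Lemma lne_rate_bracket (R : realType) (l u t c eps : R) (m : \bar R) :
  0 < t -> 0 < l -> c - eps <= ln l / t -> ln u / t <= c + eps ->
  (l%:E <= m)%E -> (m <= u%:E)%E ->
  (`|(1 / t)%:E * lne m - c%:E| <= eps%:E)%E.
Proof.
move=> t0 l0 cl uc; case: m => [m| |]//; rewrite !lee_fin => lm mu.
(* Positivity of [l] carries over to [m] and [u], so [lne m] is the real logarithm and [ln] is
   monotone between the bounds. *)
have m0 := lt_le_trans l0 lm; have u0 := lt_le_trans m0 mu.
rewrite lne_EFin// -EFinM -EFinB abse_EFin lee_fin ler_distl div1r mulrC.
apply/andP; split; [apply: le_trans cl _|apply: le_trans uc];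
  by rewrite ler_pM2r ?invr_gt0// ler_ln ?posrE.
Qed.

Lemma cvg_natr_mulr (R : realType) (c : R) : 0 < c ->
  t%:R * c @[t --> \oo] --> +oo.
Proof.
move=> c0; apply/cvgryPge => A; near=> t.
by rewrite -ler_pdivrMr//; near: t; exact: nbhs_infty_ger.
Unshelve. all: by end_near. Qed.

Theorem corollary5p6 (R : realType) (d : measure_display)
  (Omega : measurableType d) (F : nat -> set (set Omega))
  (HF : filtration F)
  (calP : set (probability Omega R)) (Q : probability Omega R)
  (alpha : nat -> R)
  (alpha_in01 : forall k, (1 <= k)%N -> 0 < alpha k < 1)
  (alpha_decr : forall j k, (1 <= j)%N -> (j <= k)%N -> alpha k <= alpha j)
  (alpha_cvg0 : alpha k @[k --> \oo] --> (0 : R))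
  (tau : nat -> Omega -> \bar R)
  (tau_stop : forall k, (1 <= k)%N -> stopping_time F (tau k))
  (tau_level : forall k, (1 <= k)%N ->
     (ereal_sup [set P [set x | tau k x < +oo] | P in calP]
        <= (alpha k)%:E)%E)
  (tau_nested : forall j k, (1 <= j)%N -> (j <= k)%N ->
     forall x, (tau j x <= tau k x)%E)
  (w : nat -> R)
  (w_ge0 : forall k, (1 <= k)%N -> 0 <= w k)
  (w_neq0 : exists2 k, (1 <= k)%N & w k != 0)
  (w_alpha : (\sum_(1 <= k <oo) (w k * alpha k)%:E <= 1)%E)
  (rho : R) (rho_in01 : 0 <= rho <= 1)
  (W_cvgy :
     cumulative_weight w (log_level alpha) x @[x --> +oo] --> +oo)
  (W_rate :
     ln (cumulative_weight w (log_level alpha) x) / x @[x --> +oo] --> rho)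
  (I : R) (I_gt0 : 0 < I)
  (tau_rate :
     ((mean Q (fun x => `|tau k x - (log_level alpha k / I)%:E|)
         / (log_level alpha k)%:E)%E @[k --> \oo] --> 0%E)
     \/
     ((mean Q (tau k) / (log_level alpha k)%:E)%E @[k --> \oo]
         --> (1 / I)%:E
      /\
      (evariance Q (tau k) / ((log_level alpha k) ^+ 2)%:E)%E @[k --> \oo]
         --> 0%E)) :
  cvg_in_probability Q
    (fun t x => ((1 / t%:R)%:E * lne (weighted_process w tau t x))%E)
    (rho * I).

Proof.
set b := log_level alpha in W_cvgy W_rate tau_rate.
have b0 k : (1 <= k)%N -> 0 < b k by exact: log_level_gt0.
have b_le j k : (1 <= j)%N -> (j <= k)%N -> b j <= b k.
  move=> j1 jk; apply: log_level_le => //; first exact: leq_trans jk.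
  exact: alpha_decr.
have b_cvgy : b k @[k --> \oo] --> +oo by exact: log_level_cvgy.
have mtau k : (1 <= k)%N -> measurable_fun setT (tau k).
  by move=> /tau_stop; exact: measurable_stopping_time.
have [n nP] := choice (fun x => level_index _ b x b_le b_cvgy).
have n1 x : (1 <= n x)%N by have [] := nP x.
have bn x k : (1 <= k)%N -> (b k <= x) = (k < n x)%N by have [_] := nP x; apply.
have WE x : cumulative_weight w b x = \sum_(1 <= k < n x) w k.
  by apply: cumulative_weightE; exact: bn.
have n_cvg : (n x).-1 @[x --> +oo] --> \oo.
  apply/cvgnyPge => A; near=> x.
  (* Using [A.+1] instead of [A] makes up for the predecessor and gives an index [>= 1]. *)
  have : b A.+1 <= x by near: x; apply: nbhs_pinfty_ge; exact: num_real.
  by rewrite bn//; case: (n x) => // m; rewrite ltnS => /ltnW.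
have n_cvg' : n x @[x --> +oo] --> \oo.
  move/cvgnyPge : n_cvg => n_cvg; apply/cvgnyPge => A.
  by apply: filterS (n_cvg A) => x /leq_trans; apply; exact: leq_pred.
move=> eps eps0.
(* Chosen so that [delta < 1 / 2] and [3 * I * delta <= eps]. As [rho <= 1], replacing [rho * I] by
   [(rho + delta) * (I * (1 + delta))] costs at most [I * (2 * delta + delta ^+ 2)], hence at most
   [eps]; the lower bound is similar. *)
pose delta := eps / (3 * I + 2 * eps).
have den0 : 0 < 3 * I + 2 * eps by lra.
have delta0 : 0 < delta by exact: divr_gt0.
have delta_half : delta < 1 / 2 by rewrite ltr_pdivrMr//; lra.
have delta_eps : 3 * I * delta <= eps.
  rewrite mulrA ler_pdivrMr//; nra.
pose dev := deviation R d Omega tau b I^-1 (delta / 2 / I).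
have dev_cvg : Q (dev k) @[k --> \oo] --> 0%E.
  have eta0 : 0 < delta / 2 / I by rewrite !divr_gt0.
  case: tau_rate => [mean_cvg|[mean_cvg var_cvg]].
    exact: concentration_of_mean.
  rewrite div1r in mean_cvg; exact: concentration_of_variance.
pose lo (t : nat) := t%:R * (I * (1 - delta)).
pose hi (t : nat) := t%:R * (I * (1 + delta)).
have lo_cvgy : lo t @[t --> \oo] --> +oo by apply: cvg_natr_mulr; rewrite mulr_gt0//; lra.
have hi_cvgy : hi t @[t --> \oo] --> +oo by apply: cvg_natr_mulr; rewrite mulr_gt0//; lra.
have n_lo : (n (lo t)).-1 @[t --> \oo] --> \oo.
  exact: (cvg_comp _ _ lo_cvgy n_cvg).
have dev_lo : Q (dev (n (lo t)).-1) @[t --> \oo] --> 0%E.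
  exact: (cvg_comp _ _ n_lo dev_cvg).
have dev_hi : Q (dev (n (hi t))) @[t --> \oo] --> 0%E.
  exact: (cvg_comp _ _ (cvg_comp _ _ hi_cvgy n_cvg') dev_cvg).
have W_gt0 : \forall x \near +oo, 0 < cumulative_weight w b x.
  by move/cvgryPgt : W_cvgy => /(_ 0).
have W_near : \forall x \near +oo, `|rho - ln (cumulative_weight w b x) / x| < delta.
  by move/cvgrPdist_lt : W_rate; apply.
(* The bad event is covered by two deviation events: one at the last index with level at most
   [lo t], one at the first index with level above [hi t]. *)
apply: (@squeeze_cvge _ _ _ _ (fun=> 0%E) _
  (fun t => Q (dev (n (lo t)).-1) + Q (dev (n (hi t))))%E); last 2 first.
- exact: cvg_cst.
- by rewrite -[0%E]adde0; apply: cvgeD.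
near=> t.
have t1 : (1 <= t)%N by near: t; exists 1%N.
have t0 : (0 : R) < t%:R by rewrite ltr0n.
(* The entry at index 0 carries no hypotheses, so the last index below [lo t] has to be a genuine
   one. *)
have lo1 : (1 <= (n (lo t)).-1)%N.
  by near: t; move/cvgnyPge : n_lo => /(_ 1%N).
have Wlo0 : 0 < cumulative_weight w b (lo t).
  by near: t; exact: (lo_cvgy _ W_gt0).
have Wlo : `|rho - ln (cumulative_weight w b (lo t)) / lo t| < delta.
  by near: t; exact: (lo_cvgy _ W_near).
have Whi : `|rho - ln (cumulative_weight w b (hi t)) / hi t| < delta.
  by near: t; exact: (hi_cvgy _ W_near).
have mdev k : (1 <= k)%N -> measurable (dev k) by exact: measurable_deviation.
have mS : measurable [set x | (eps%:E <
    `|(1 / t%:R)%:E * lne (weighted_process w tau t x) - (rho * I)%:E|)%E].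
  rewrite -[X in measurable X]setTI; apply: emeasurable_fun_o_infty => //.
  apply: measurableT_comp => //; apply: emeasurable_funB => //.
  apply: emeasurable_funM => //; apply: measurable_fun_lne.
  exact: measurable_weighted_process.
apply/andP; split; first exact: measure_ge0.
apply: (@le_trans _ _ (Q (dev (n (lo t)).-1 `|` dev (n (hi t))))); last first.
  by apply: measureU2; exact: mdev.
apply: le_measure; rewrite ?inE//; first by apply: measurableU; exact: mdev.
move=> x /= dist; apply: contrapT => /not_orP[ndev_lo ndev_hi].
move: dist; apply/negP; rewrite -leNgt.
have tau_lo : (tau (n (lo t)).-1 x <= t%:R%:E)%E.
  rewrite leNgt; apply/negP => tlt; apply: ndev_lo.
  apply: deviation_gt tlt => //; first by rewrite delta0; lra.
  by rewrite bn// prednK.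
have tau_hi : (t%:R%:E < tau (n (hi t)) x)%E.
  rewrite ltNge; apply/negP => tlt; apply: ndev_hi.
  apply: deviation_le tlt => //; first by rewrite delta0; lra.
  by rewrite ltNge bn// ltnn.
apply: (@lne_rate_bracket _ (cumulative_weight w b (lo t))
  (cumulative_weight w b (hi t))) => //.
(* The known rate is [ln W / lo t]; passing to division by [t] brings out the factor
   [I * (1 - delta)]. *)
- have -> : ln (cumulative_weight w b (lo t)) / t%:R =
      ln (cumulative_weight w b (lo t)) / lo t * (I * (1 - delta)).
    by rewrite /lo; field; rewrite !gt_eqF//; lra.
  move: Wlo; rewrite ltr_distlC => /andP[Wlo _].
  apply: (@le_trans _ _ ((rho - delta) * (I * (1 - delta)))); first by nra.
  by rewrite ler_pM2r; [exact: ltW|rewrite mulr_gt0//; lra].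
- have -> : ln (cumulative_weight w b (hi t)) / t%:R =
      ln (cumulative_weight w b (hi t)) / hi t * (I * (1 + delta)).
    by rewrite /hi; field; rewrite !gt_eqF//; lra.
  move: Whi; rewrite ltr_distlC => /andP[_ Whi].
  apply: (@le_trans _ _ ((rho + delta) * (I * (1 + delta)))); last by nra.
  by rewrite ler_pM2r; [exact: ltW|rewrite mulr_gt0//; lra].
(* Every index [k < n (lo t)] is at most the predecessor of [n (lo t)], so nesting transfers
   [tau_lo] to it. *)
- rewrite WE; apply: weighted_process_ge => // k /andP[k1 kn].
  by apply: le_trans tau_lo; apply: tau_nested => //; rewrite -ltnS prednK.
- rewrite WE; apply: weighted_process_le => // k nk.
  by apply: (lt_le_trans tau_hi); exact: tau_nested.
Unshelve. all: by end_near. 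
Qed.
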